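(* The $\exists$NE problem restricted to coordination games $\mathcal{G}(G,w,C,\beta)$ whose underlying graph $G$ is a simple cycle can be solved in $\mathcal{O}(|G|)$ time.
   Context: Coordination games. Fix a finite set of colours $M$, $m=|M|$. Let $G=(V,E)$ be a finite directed graph without self loops on $n>1$ nodes, $e=|E|$; $w$ assigns to each edge a nonnegative rational weight; $C:V\to 2^M\setminus\{\emptyset\}$ is a colour assignment; $\beta:V\times M\to\mathbb{Z}$ is a bonus function. In the game $\mathcal{G}(G,w,C,\beta)$ the players are the nodes, the strategy set of node $i$ is $C(i)$, and for a joint strategy $s$ (with $s(i)\in C(i)$ for all $i$) the payoff of $i$ is $p_i(s)=\sum_{j\in N_i:\,s(i)=s(j)} w_{j\to i}+\beta(i,s(i))$, where $N_i=\{j : (j\to i)\in E\}$. A (pure) Nash equilibrium is a joint strategy $s$ such that for every $i$ and every $x\in C(i)$, $p_i(s)\ge p_i(x,s_{-i})$. The graph is a simple cycle if $V=\{0,1,\dots,n-1\}$ and the edges are exactly $0\to1\to\cdots\to n-1\to0$. A query is a function $q:Q\to M$ with $\emptyset\ne Q\subseteq V$ and $q(i)\in C(i)$ for all $i\in Q$. A joint strategy $s$ is consistent with $q$ if $s(i)=q(i)$ for all $i\in Q$. $\exists$NE problem: given $G,w,C,\beta,q$, decide whether some Nash equilibrium of $\mathcal{G}(G,w,C,\beta)$ is consistent with $q$. The size of the game graph is $|G|=\mathcal{O}(nm+e)$. Weights and bonuses are given in binary; running time is measured in the number of arithmetic operations. *)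

(* Defs.v *)
From HB Require Import structures.
From mathcomp Require Import all_boot all_order all_algebra.

Set Implicit Arguments.
Unset Strict Implicit.
Unset Printing Implicit Defensive.

Import Order.TTheory GRing.Theory Num.Theory.
Local Open Scope ring_scope.

(** * Coordination games on directed graphs *)

(* The values of [weight] off the edges are irrelevant: neither the payoffs
   nor the encoding of the input below look at them. *)
Record game (n m : nat) := Game {
  edge : rel 'I_n;
  edge_irr : irreflexive edge;
  weight : 'I_n -> 'I_n -> rat;  (* [weight j i] is the weight of j -> i *)
  weight_ge0 : forall j i, edge j i -> 0 <= weight j i;
  colours : 'I_n -> {set 'I_m};
  colours_neq0 : forall i, colours i != set0;
  bonus : 'I_n -> 'I_m -> int
}.

Section Games.
Context {n m : nat} (g : game n m).
Implicit Types (s : {ffun 'I_n -> 'I_m}) (i : 'I_n) (x : 'I_m).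

Definition joint_strategy s : Prop := forall i, s i \in colours g i.

Definition payoff s i : rat :=
  \sum_(j | edge g j i && (s i == s j)) weight g j i + (bonus g i (s i))%:~R.

Definition deviate s i x : {ffun 'I_n -> 'I_m} :=
  [ffun j => if j == i then x else s j].

Definition Nash_equilibrium s : Prop :=
  joint_strategy s /\
  forall i x, x \in colours g i -> payoff (deviate s i x) i <= payoff s i.

(* A query q : Q -> M with Q a subset of V is a partial function on V. *)
Record query := Query {
  query_fun :> 'I_n -> option 'I_m;
  query_neq0 : exists i, query_fun i != None;
  query_colours : forall i x, query_fun i = Some x -> x \in colours g i
}.

Definition consistent s (q : query) : Prop := forall i x, q i = Some x -> s i = x.

Definition exists_NE (q : query) : Prop :=
  exists s, Nash_equilibrium s /\ consistent s q.

(* [ordS j] is the ordinal j + 1 mod n. *)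
Definition simple_cycle : Prop := forall j i, edge g j i = (i == ordS j).

Definition edges : {set 'I_n * 'I_n} := [set a | edge g a.1 a.2].

Definition game_size : nat := (n * m + #|edges|)%N.

End Games.

(** * Random access programs with unit-cost arithmetic *)

(* Registers and array cells hold rationals. Addition, subtraction and
   comparison are the only arithmetic operations. *)
Record store := Store {
  reg : nat -> rat;
  arr : nat -> nat -> rat
}.

Definition upd {T : Type} (f : nat -> T) (k : nat) (v : T) : nat -> T :=
  fun l => if l == k then v else f l.

Definition set_reg (st : store) (x : nat) (v : rat) : store :=
  Store (upd (reg st) x v) (arr st).

Definition set_arr (st : store) (a k : nat) (v : rat) : store :=
  Store (reg st) (upd (arr st) a (upd (arr st a) k v)).

(* All arguments of type [nat] are names of registers, except the array name
   [a]; only the indices into arrays are computed at run time. *)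
Inductive cmd :=
| Const (x : nat) (c : int)            (* x := c *)
| Move (x y : nat)                     (* x := y *)
| Add (x y z : nat)                    (* x := y + z *)
| Sub (x y z : nat)                    (* x := y - z *)
| Read (x a y : nat)                   (* x := a[y] *)
| Write (a x y : nat)                  (* a[x] := y *)
| Seq (p1 p2 : cmd)                    (* p1; p2 *)
| If (x y : nat) (p1 p2 : cmd)         (* if x < y then p1 else p2 *)
| While (x y : nat) (p : cmd).         (* while x < y do p *)

(* [exec p st t st']: started in [st], [p] halts in [st'] after exactly [t]
   operations. Every assignment, memory access and test counts for one.
   Accessing an array at an index that is not a natural number is an error
   (no rule applies). *)
Inductive exec : cmd -> store -> nat -> store -> Prop :=
| ExecConst x c st : exec (Const x c) st 1%N (set_reg st x c%:~R)
| ExecMove x y st : exec (Move x y) st 1%N (set_reg st x (reg st y))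
| ExecAdd x y z st :
    exec (Add x y z) st 1%N (set_reg st x (reg st y + reg st z))
| ExecSub x y z st :
    exec (Sub x y z) st 1%N (set_reg st x (reg st y - reg st z))
| ExecRead x a y st (k : nat) : reg st y = k%:R ->
    exec (Read x a y) st 1%N (set_reg st x (arr st a k))
| ExecWrite a x y st (k : nat) : reg st x = k%:R ->
    exec (Write a x y) st 1%N (set_arr st a k (reg st y))
| ExecSeq p1 p2 st1 t1 st2 t2 st3 :
    exec p1 st1 t1 st2 -> exec p2 st2 t2 st3 ->
    exec (Seq p1 p2) st1 (t1 + t2)%N st3
| ExecIfTrue x y p1 p2 st t st' : reg st x < reg st y ->
    exec p1 st t st' -> exec (If x y p1 p2) st t.+1 st'
| ExecIfFalse x y p1 p2 st t st' : reg st y <= reg st x ->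
    exec p2 st t st' -> exec (If x y p1 p2) st t.+1 st'
| ExecWhileTrue x y p st1 t1 st2 t2 st3 : reg st1 x < reg st1 y ->
    exec p st1 t1 st2 -> exec (While x y p) st2 t2 st3 ->
    exec (While x y p) st1 (t1 + t2).+1%N st3
| ExecWhileFalse x y p st : reg st y <= reg st x ->
    exec (While x y p) st 1%N st.

(** * Encoding of instances and answers *)

(* The edges may be listed in the input in any order. *)
Definition edge_list {n m : nat} (g : game n m) (es : seq ('I_n * 'I_n)) : Prop :=
  uniq es /\ es =i edges g.

(* Registers 0, 1, 2 hold n, m, e. Arrays 0, 1, 2 hold the sources, targets and
   weights of the listed edges; arrays 3 and 4 hold, at index i * m + x, the
   0-1 value of "x is in C(i)" and beta(i, x); array 5 holds, at index i, 0 if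
   the query is undefined at i and q(i) + 1 otherwise. All the rest is 0. *)
Definition input {n m : nat} (g : game n m) (q : query g)
    (es : seq ('I_n * 'I_n)) : store :=
  let regs : seq rat := [:: n%:R; m%:R; (size es)%:R] in
  let src : seq rat := [seq (nat_of_ord a.1)%:R | a <- es] in
  let tgt : seq rat := [seq (nat_of_ord a.2)%:R | a <- es] in
  let wgt : seq rat := [seq weight g a.1 a.2 | a <- es] in
  let col : seq rat :=
    [seq (x \in colours g i)%:R | i <- enum 'I_n, x <- enum 'I_m] in
  let bon : seq rat :=
    [seq (bonus g i x)%:~R | i <- enum 'I_n, x <- enum 'I_m] in
  let qry : seq rat :=
    [seq if q i is Some x then (nat_of_ord x).+1%:R else 0 | i <- enum 'I_n] in
  Store (fun x => nth 0 regs x)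
        (fun a k => nth 0 (nth [::] [:: src; tgt; wgt; col; bon; qry] a) k).

(* The answer is left in register 0. *)
Definition answers (st : store) (A : Prop) : Prop :=
  (reg st 0 = 1 /\ A) \/ (reg st 0 = 0 /\ ~ A).

(* Main.v *)
Require Import Defs.
From mathcomp Require Import all_boot all_order all_algebra.
From mathcomp Require Import zify.

(* A Nash equilibrium on a cycle is a closed walk of colours in which every node
   best-responds to its predecessor. The query fixes the colour c of some node
   i0; starting from {c}, propagate once around the cycle the set R of colours
   that a node can have when its predecessor's colour lies in the previous R. An
   equilibrium consistent with the query exists iff c is in the last set. Let M
   be the maximal bonus at node i and w its incoming weight. An available colour
   x allowed by the query enters the new set iff it is in R and
   bonus x + w >= M, or bonus x = M and some y in R is unavailable at i or
   has bonus y + w <= M. This takes O(m) operations per node. *)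

Set Implicit Arguments.
Unset Strict Implicit.
Unset Printing Implicit Defensive.

Import Order.TTheory GRing.Theory Num.Theory.
Local Open Scope ring_scope.

(** * Best responses on a cycle *)

Section Cycle.
Context {n m : nat} (g : game n m) (q : query g).
Hypothesis cyc : simple_cycle g.
Implicit Types (i : 'I_n) (x y z : 'I_m) (R : {set 'I_m}).

Definition pred_weight i : rat := weight g (ord_pred i) i.

Definition gain i y x : rat :=
  (bonus g i x)%:~R + (if x == y then pred_weight i else 0).

Definition best_responses i y : {set 'I_m} :=
  [set x in colours g i | [forall z in colours g i, gain i y z <= gain i y x]].

Definition allowed i x : bool := if q i is Some c then x == c else true.

Definition next_colours i R : {set 'I_m} :=
  [set x | allowed i x && [exists y in R, x \in best_responses i y]].

Lemma edge_pred i : edge g (ord_pred i) i.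
Proof. by rewrite cyc ord_predK. Qed.

Lemma edge_cycleE j i : edge g j i = (j == ord_pred i).
Proof. by rewrite cyc -(inj_eq (@ordS_inj n) j) ord_predK eq_sym. Qed.

Lemma pred_weight_ge0 i : 0 <= pred_weight i.
Proof. exact/weight_ge0/edge_pred. Qed.

(** A one-node cycle would be a self loop. Hence a deviation of [i] leaves the colour of its
    predecessor alone. *)
Lemma ord_pred_neq i : ord_pred i != i.
Proof.
by apply/eqP => e; have := edge_pred i; rewrite e (edge_irr g).
Qed.

Lemma payoff_cycle s i : payoff g s i = gain i (s (ord_pred i)) (s i).
Proof.
rewrite /payoff /gain addrC; congr (_ + _).
rewrite (eq_bigl (fun j => (j == ord_pred i) && (s i == s j))); last first.
  by move=> j; rewrite edge_cycleE.
case: ifP => e; last first.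
  by rewrite big1 // => j /andP[/eqP ->]; rewrite e.
by rewrite (big_pred1 (ord_pred i)) // => j /=; case: eqP => // ->.
Qed.

Lemma Nash_equilibrium_cycleP s :
  Nash_equilibrium g s <-> forall i, s i \in best_responses i (s (ord_pred i)).
Proof.
have dev i x : payoff g (deviate s i x) i = gain i (s (ord_pred i)) x.
  by rewrite payoff_cycle !ffunE eqxx (negPf (ord_pred_neq i)).
split=> [[js ne] i|br].
  rewrite inE js; apply/forall_inP => x xC.
  by rewrite -dev -payoff_cycle ne.
split=> [i|i x xC]; first by have := br i; rewrite inE => /andP[].
rewrite dev payoff_cycle; have := br i; rewrite inE => /andP[_ /forall_inP].
exact.
Qed.

(** A relation rather than a computed maximum, so that it can be asserted of the value held in a
    register. *)
Definition max_bonus i (M : rat) : Prop :=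
  (exists2 z, z \in colours g i & (bonus g i z)%:~R = M) /\
  forall z, z \in colours g i -> (bonus g i z)%:~R <= M.

(* A best response either copies the predecessor or has maximal bonus, and the
   latter is a best response unless copying is strictly better. *)
Lemma mem_next_colours i R M x : max_bonus i M ->
  (x \in next_colours i R) =
    [&& x \in colours g i, allowed i x &
      (M <= (bonus g i x)%:~R) &&
        [exists y in R, ~~ ((y \in colours g i) &&
                            (M < (bonus g i y)%:~R + pred_weight i))]
      || (x \in R) && (M <= (bonus g i x)%:~R + pred_weight i)].
Proof.
move=> [[z0 z0C <-] maxM]; have w0 := pred_weight_ge0 i.
rewrite inE [RHS]andbCA; congr (_ && _).
apply/exists_inP/andP => [[y yR]|[xC]].
  rewrite inE => /andP[xC /forall_inP br]; split=> //.
  have /= := br _ z0C; rewrite /gain.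
  have [xy|xNy] := eqVneq x y.
    rewrite xy in yR xC br *; rewrite yR => le0; apply/orP; right => /=.
    by apply: le_trans le0; rewrite lerDl; case: ifP.
  rewrite addr0 => le0; apply/orP; left; apply/andP; split.
    by apply: le_trans le0; rewrite lerDl; case: ifP.
  apply/exists_inP; exists y => //; apply/negP => /andP[yC].
  apply/negP; rewrite -leNgt.
  (* Copying [y] is an available deviation, so it gains at most what [x] does, which is at most
     [M]. *)
  have := br _ yC; rewrite /gain eqxx (negPf xNy) addr0 => /le_trans; apply.
  exact: maxM.
case/orP=> [/andP[le0 /exists_inP[y yR bad]]|/andP[xR le0]].
  exists y => //; rewrite inE xC; apply/forall_inP => z zC; rewrite /gain.
  apply: (@le_trans _ _ (bonus g i x)%:~R); last by rewrite lerDl; case: ifP.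
  apply: le_trans le0; case: eqP => [e|_]; last by rewrite addr0 maxM.
  by move: bad; rewrite -e zC /= -leNgt.
exists x => //; rewrite inE xC; apply/forall_inP => z zC; rewrite /gain eqxx.
case: eqP => [->//|_]; rewrite addr0; exact: le_trans (maxM _ zC) le0.
Qed.

(** * Closed walks around the cycle *)

Hypothesis n_gt0 : (0 < n)%N.

Definition node_after (i0 : 'I_n) (k : nat) : 'I_n :=
  Ordinal (ltn_pmod (i0 + k) n_gt0).

Lemma ord_pred_node_after i0 k :
  ord_pred (node_after i0 k.+1) = node_after i0 k.
Proof.
apply: (@ordS_inj n); rewrite ord_predK; apply: val_inj => /=.
by rewrite addnS -[in RHS]addn1 modnDml addn1.
Qed.

Lemma node_after0 i0 : node_after i0 0 = i0.
Proof. by apply: val_inj; rewrite /= addn0 modn_small. Qed.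

Lemma node_after_n i0 : node_after i0 n = i0.
Proof. by apply: val_inj; rewrite /= modnDr modn_small. Qed.

(** The offsets run from 1 to [n], not from 0: node [i0] is met on the return, where its own
    conditions are checked. *)
Lemma node_after_surj i0 i : exists2 k, (k < n)%N & node_after i0 k.+1 = i.
Proof.
exists ((i + n - i0.+1) %% n)%N; first by rewrite ltn_pmod.
apply: val_inj => /=.
rewrite addnS -addSn modnDmr subnKC ?modnDr ?modn_small //.
exact: leq_trans (ltn_ord i0) (leq_addl _ _).
Qed.

(** Step 0 imposes no condition on [c] at [i0]; step [n] comes back to [i0] and imposes it there. *)
Fixpoint reachable (i0 : 'I_n) (c : 'I_m) (k : nat) : {set 'I_m} :=
  if k is l.+1 then next_colours (node_after i0 k) (reachable i0 c l)
  else [set c].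

(** Induction on [k]. A walk is a total function on [nat], so extending it just overwrites its value
    at [k.+1]. *)
Lemma reachableP i0 c k x :
  reflect (exists2 f : nat -> 'I_m, f 0%N = c /\ f k = x &
             forall l, (l < k)%N ->
               allowed (node_after i0 l.+1) (f l.+1) /\
               f l.+1 \in best_responses (node_after i0 l.+1) (f l))
          (x \in reachable i0 c k).
Proof.
elim: k x => [|k IH] x.
  rewrite /= inE; apply: (iffP eqP) => [->|[f [<- <-]] //].
  by exists (fun=> c).
rewrite /= inE; apply: (iffP andP) => [[ax /exists_inP[y]]|].
  case/IH=> f [f0 fk] fP xb.
  exists (fun l => if l == k.+1 then x else f l); rewrite ?eqxx //.
  move=> l; rewrite ltnS leq_eqVlt => /predU1P[->|lk].
    by rewrite eqxx ltn_eqF // fk.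
  by rewrite eqSS !ltn_eqF ?(ltnW lk) //; [exact: fP|rewrite ltnS ltnW].
move=> [f [f0 fk] fP]; have [] := fP k (ltnSn k); rewrite fk => ax bx.
split=> //; apply/exists_inP; exists (f k) => //.
by apply/IH; exists f => // l lk; apply: fP; exact: ltnW.
Qed.

(** An equilibrium read from [i0] onwards is a walk from [c] back to [c]; conversely, such a walk
    folds into a joint strategy. *)
Lemma exists_NE_reachable i0 c : q i0 = Some c ->
  exists_NE q <-> c \in reachable i0 c n.
Proof.
move=> qc; split=> [[s [/Nash_equilibrium_cycleP ne cs]]|].
  apply/reachableP; exists (fun k => s (node_after i0 k)).
    by rewrite node_after0 node_after_n (cs _ _ qc).
  move=> l _; split; last by rewrite -(ord_pred_node_after i0 l) ne.
  by rewrite /allowed; case e: (q _) => [d|//]; rewrite (cs _ _ e).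
case/reachableP => f [f0 fn] fP.
(* The argument of [f] is the distance from [i0] to [i] along the cycle; adding [n] keeps the
   truncated subtraction exact. *)
pose s : {ffun 'I_n -> 'I_m} :=
  [ffun i : 'I_n => f ((i + n - i0) %% n)%N].
(* At [k = n] the strategy reads [f 0], so the walk has to close up: [f 0 = c = f n]. *)
have sE k : (k <= n)%N -> s (node_after i0 k) = f k.
  rewrite leq_eqVlt ffunE => /predU1P[->|kn].
    by rewrite node_after_n fn addnC addnK modnn f0.
  congr f; rewrite -[RHS](modn_small kn); apply/eqP.
  rewrite -(eqn_modDl i0) subnKC; last first.
    exact: leq_trans (ltnW (ltn_ord i0)) (leq_addl _ _).
  by rewrite /= modnDr modn_mod.
exists s; split.
  apply/Nash_equilibrium_cycleP => i; have [k kn <-] := node_after_surj i0 i.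
  by rewrite ord_pred_node_after !sE ?(ltnW kn) //; case: (fP k kn).
move=> i x qx; have [k kn e] := node_after_surj i0 i.
by have [] := fP k kn; rewrite -e sE // /allowed e qx => /eqP.
Qed.

End Cycle.

(** * Time-bounded program logic *)

Definition halts_within (T : nat) (p : cmd) (st : store) (Q : store -> Prop) :=
  exists t st', [/\ exec p st t st', (t <= T)%N & Q st'].

Fixpoint written_regs (p : cmd) : seq nat :=
  match p with
  | Const x _ | Move x _ | Add x _ _ | Defs.Sub x _ _ | Read x _ _ => [:: x]
  | Write _ _ _ => [::]
  | Seq p1 p2 | If _ _ p1 p2 => written_regs p1 ++ written_regs p2
  | While _ _ p1 => written_regs p1
  end.

Fixpoint written_arrs (p : cmd) : seq nat :=
  match p with
  | Const _ _ | Move _ _ | Add _ _ _ | Defs.Sub _ _ _ | Read _ _ _ => [::]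
  | Write a _ _ => [:: a]
  | Seq p1 p2 | If _ _ p1 p2 => written_arrs p1 ++ written_arrs p2
  | While _ _ p1 => written_arrs p1
  end.

(** The frame is syntactic: that a register or an array survives [p] reduces to a computed
    membership test. *)
Definition unchanged (p : cmd) (st st' : store) : Prop :=
  (forall x, x \notin written_regs p -> reg st' x = reg st x) /\
  (forall a, a \notin written_arrs p -> arr st' a = arr st a).

Lemma exec_unchanged p st t st' : exec p st t st' -> unchanged p st st'.
Proof.
elim=> {p st t st'};
  try by move=> x *; split=> z //=; rewrite /upd mem_seq1 => /negPf ->.
- move=> p1 p2 st1 t1 st2 t2 st3 _ [r1 a1] _ [r2 a2].
  split=> z /=; rewrite mem_cat => /norP[h1 h2].
    by rewrite r2 // r1.
  by rewrite a2 // a1.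
- move=> x y p1 p2 st t st' _ _ [r a].
  by split=> z /=; rewrite mem_cat => /norP[h1 h2]; rewrite ?r ?a.
- move=> x y p1 p2 st t st' _ _ [r a].
  by split=> z /=; rewrite mem_cat => /norP[h1 h2]; rewrite ?r ?a.
- move=> x y p st1 t1 st2 t2 st3 _ _ [r1 a1] _ [r2 a2].
  by split=> z /= h; rewrite ?r2 ?r1 ?a2 ?a1.
Qed.

Lemma unchanged_trans p st1 st2 st3 :
  unchanged p st1 st2 -> unchanged p st2 st3 -> unchanged p st1 st3.
Proof.
by move=> [r1 a1] [r2 a2]; split=> z h; rewrite ?r2 ?r1 ?a2 ?a1.
Qed.

(** The second premise also receives the frame of [p1], so [Q1] need only record what [p1]
    computes. *)
Lemma halts_within_seq T1 T2 p1 p2 st (Q1 Q : store -> Prop) :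
  halts_within T1 p1 st Q1 ->
  (forall st1, unchanged p1 st st1 -> Q1 st1 -> halts_within T2 p2 st1 Q) ->
  halts_within (T1 + T2) (Seq p1 p2) st Q.
Proof.
move=> [t1 [st1 [e1 le1 q1]]] /(_ st1 (exec_unchanged e1) q1).
move=> [t2 [st2 [e2 le2 q2]]]; exists (t1 + t2)%N, st2; split=> //.
  exact: ExecSeq e1 e2.
exact: leq_add.
Qed.

Lemma halts_within_le T T' p st (Q Q' : store -> Prop) :
  halts_within T p st Q -> (T <= T')%N -> (forall st', Q st' -> Q' st') ->
  halts_within T' p st Q'.
Proof.
move=> [t [st' [e le q]]] leT QQ; exists t, st'; split=> //.
  exact: leq_trans leT.
exact: QQ.
Qed.

Lemma halts_within_frame T p st (Q Q' : store -> Prop) :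
  halts_within T p st Q ->
  (forall st', unchanged p st st' -> Q st' -> Q' st') -> halts_within T p st Q'.
Proof.
move=> [t [st' [e le h]]] QQ'; exists t, st'; split=> //.
exact: QQ' (exec_unchanged e) h.
Qed.

(** Weakest preconditions for loop-free code. The value [False] at a loop leaves loops to
    [halts_within_for]. *)
Fixpoint wp (p : cmd) (Q : store -> Prop) (st : store) : Prop :=
  match p with
  | Const x c => Q (set_reg st x c%:~R)
  | Move x y => Q (set_reg st x (reg st y))
  | Add x y z => Q (set_reg st x (reg st y + reg st z))
  | Defs.Sub x y z => Q (set_reg st x (reg st y - reg st z))
  | Read x a y =>
      exists2 k : nat, reg st y = k%:R & Q (set_reg st x (arr st a k))
  | Write a x y =>
      exists2 k : nat, reg st x = k%:R & Q (set_arr st a k (reg st y))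
  | Seq p1 p2 => wp p1 (wp p2 Q) st
  | If x y p1 p2 => if reg st x < reg st y then wp p1 Q st else wp p2 Q st
  | While _ _ _ => False
  end.

(** Adding up both branches of a test bounds either one independently of the store. *)
Fixpoint cost (p : cmd) : nat :=
  match p with
  | Seq p1 p2 => cost p1 + cost p2
  | If _ _ p1 p2 => (cost p1 + cost p2).+1
  | _ => 1
  end.

Lemma wp_halts p Q st : wp p Q st -> halts_within (cost p) p st Q.
Proof.
elim: p Q st => /=
  [x c|x y|x y z|x y z|x a y|a x y|p1 IH1 p2 IH2|x y p1 IH1 p2 IH2|//] Q st.
- by move=> h; do 2!eexists; split; [exact: ExecConst| |exact: h].
- by move=> h; do 2!eexists; split; [exact: ExecMove| |exact: h].
- by move=> h; do 2!eexists; split; [exact: ExecAdd| |exact: h].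
- by move=> h; do 2!eexists; split; [exact: ExecSub| |exact: h].
- by case=> k e h; do 2!eexists; split; [exact: ExecRead e| |exact: h].
- by case=> k e h; do 2!eexists; split; [exact: ExecWrite e| |exact: h].
- move/IH1 => h; apply: halts_within_seq h _ => st1 _; exact: IH2.
- case: ltP => c.
  + move/IH1 => [t [st' [e le h]]]; exists t.+1, st'; split=> //.
      exact: ExecIfTrue.
    by rewrite ltnS (leq_trans le) // leq_addr.
  + move/IH2 => [t [st' [e le h]]]; exists t.+1, st'; split=> //.
      exact: ExecIfFalse.
    by rewrite ltnS (leq_trans le) // leq_addl.
Qed.

(** Each of the [N] rounds costs the body, one test and one increment, hence [T.+2]; the final
    successor is the failing test. The invariant for [k.+1] is stated after the increment of the
    counter. *)
Lemma halts_within_for c b d body T (I : nat -> store -> Prop) N st :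
  let loop := While c b (Seq body (Add c c d)) in
  [&& c \notin written_regs body, b \notin written_regs loop &
      d \notin written_regs loop] ->
  reg st c = 0 -> reg st b = N%:R -> reg st d = 1 -> I 0%N st ->
  (forall k st', (k < N)%N -> unchanged loop st st' -> reg st' c = k%:R ->
     I k st' ->
     halts_within T body st' (fun st'' => I k.+1 (set_reg st'' c k.+1%:R))) ->
  halts_within (N * T.+2).+1 loop st (I N).
Proof.
move=> loop /and3P[cW bW dW] c0 bN d1 I0 step.
(* Induction on the number [j] of rounds left, from an arbitrary intermediate store. *)
suff gen : forall j k st', (k + j = N)%N -> unchanged loop st st' ->
    reg st' c = k%:R -> I k st' -> halts_within (j * T.+2).+1 loop st' (I N).
  by apply: (gen N 0%N).
elim=> [|j IH] k st' kj un ck Ik.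
  exists 1%N, st'; split=> //; last by rewrite -kj addn0.
  by apply: ExecWhileFalse; rewrite ck un.1 // bN -kj addn0.
have kN : (k < N)%N by rewrite -kj addnS ltnS leq_addr.
have [t1 [st1 [e1 le1 I1]]] := step k st' kN un ck Ik.
set st2 := set_reg st1 c k.+1%:R in I1.
have e2 : exec (Seq body (Add c c d)) st' (t1 + 1) st2.
  have un1 := exec_unchanged e1; apply: ExecSeq e1 _; rewrite /st2.
  have [cb db] : c \notin written_regs body /\ d \notin written_regs body.
    by move: dW; rewrite /= mem_cat => /norP[].
  have -> : k.+1%:R = reg st1 c + reg st1 d :> rat.
    by rewrite !un1.1 // ck un.1 // d1 -natr1.
  exact: ExecAdd.
have [|||t3 [st3 [e3 le3 I3]]] := IH k.+1 st2 _ _ _ I1.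
- by rewrite addSnnS.
- exact: unchanged_trans un (exec_unchanged e2).
- by rewrite /= /upd eqxx.
exists (t1 + 1 + t3).+1, st3; split=> //.
  apply: ExecWhileTrue e2 e3.
  by rewrite ck un.1 // bN ltr_nat.
by rewrite ltnS mulSn addn1; lia.
Qed.

(** * The program *)

(* The machine has no multiplication: rbase is kept equal to rnode * m, and ridx
   runs through the indices rnode * m + rx of the colour and bonus arrays. *)
Local Notation rn := 0%N.
Local Notation rm := 1%N.
Local Notation re := 2%N.
Local Notation rzero := 3%N.
Local Notation rone := 4%N.
Local Notation rnode := 5%N.
Local Notation rbase := 6%N.
Local Notation rstart := 7%N.
Local Notation rround := 8%N.
Local Notation rk := 9%N.
Local Notation rtmp := 10%N.
Local Notation rweight := 11%N.
Local Notation rquery := 12%N.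
Local Notation rx := 13%N.
Local Notation ridx := 14%N.
Local Notation rmax := 15%N.
Local Notation rfound := 16%N.
Local Notation rswitch := 17%N.
Local Notation ravail := 18%N.
Local Notation rbonus := 19%N.
Local Notation rreach := 20%N.
Local Notation rcopy := 21%N.
Local Notation rnew := 22%N.
Local Notation rnext := 23%N.

Local Notation atgt := 1%N.
Local Notation aedge := 2%N.
Local Notation acol := 3%N.
Local Notation abonus := 4%N.
Local Notation aquery := 5%N.
Local Notation aweight := 6%N.
Local Notation areach := 7%N.

Definition skip : cmd := Move rtmp rtmp.

Definition sweep (body : cmd) : cmd :=
  Seq (Seq (Move rx rzero) (Move ridx rbase))
      (While rx rm (Seq (Seq body (Add ridx ridx rone)) (Add rx rx rone))).

(** [rfound] tells whether [rmax] is meaningful yet: bonuses may be negative, so no constant is a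
    safe initial maximum. *)
Definition max_body : cmd :=
  Seq (Read ravail acol ridx) (Seq (Read rbonus abonus ridx)
    (If rzero ravail
      (If rfound rone
        (Seq (Move rmax rbonus) (Move rfound rone))
        (If rmax rbonus (Move rmax rbonus) skip))
      skip)).

(** [rswitch] becomes 1 when some reachable predecessor colour makes the colours of maximal bonus
    best responses. *)
Definition switch_body : cmd :=
  Seq (Read ravail acol ridx) (Seq (Read rbonus abonus ridx)
  (Seq (Read rreach areach rx) (Seq (Add rcopy rbonus rweight)
    (If rzero rreach
      (If rzero ravail (If rmax rcopy skip (Move rswitch rone))
        (Move rswitch rone))
      skip)))).

(** The machine tests only [<], so each condition of the form [<=] is found in an else branch. *)
Definition test_new : cmd :=
  Seq (If rzero rswitch (If rbonus rmax skip (Move rnew rone)) skip)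
      (If rzero rreach (If rcopy rmax skip (Move rnew rone)) skip).

(* Colours and queries are compared in the shifted encoding x + 1 of the input. *)
Definition update_body : cmd :=
  Seq (Read ravail acol ridx) (Seq (Read rbonus abonus ridx)
  (Seq (Read rreach areach rx) (Seq (Add rcopy rbonus rweight)
  (Seq (Const rnew 0) (Seq (Add rnext rx rone)
  (Seq
    (If rzero ravail
      (If rzero rquery
        (If rquery rnext skip (If rnext rquery skip test_new))
        test_new)
      skip)
    (Write areach rx rnew))))))).

(** The move comes before the processing of a node, so the starting node is processed last. *)
Definition advance : cmd :=
  Seq (Add rnode rnode rone) (Seq (Add rbase rbase rm)
  (Seq (If rnode rn skip (Seq (Const rnode 0) (Const rbase 0)))
  (Seq (Read rweight aweight rnode) (Seq (Read rquery aquery rnode)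
  (Seq (Const rfound 0) (Const rswitch 0)))))).

Definition step : cmd :=
  Seq advance
    (Seq (sweep max_body) (Seq (sweep switch_body) (sweep update_body))).

(** Only one edge enters each node of a cycle, so weights listed in any order can be stored by
    target. *)
Definition load_weights : cmd :=
  While rk re (Seq
    (Seq (Read rtmp atgt rk) (Seq (Read rweight aedge rk)
         (Write aweight rtmp rweight)))
    (Add rk rk rone)).

(** Here [rx] runs through the nodes and [ridx] through their row offsets. Any queried node can
    serve as start; the last one found is kept. *)
Definition find_query_body : cmd :=
  Seq (Read rquery aquery rx)
  (Seq (If rzero rquery
         (Seq (Move rnode rx) (Seq (Move rbase ridx) (Move rnext rquery)))
         skip)
       (Add ridx ridx rm)).

Definition find_query : cmd :=
  While rx rn (Seq find_query_body (Add rx rx rone)).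

(** [rzero] and the loop counters rely on registers being 0 initially. The last read leaves the bit
    of the starting colour in [rn], which is the answer register. *)
Definition solve : cmd :=
  Seq (Const rone 1) (Seq load_weights (Seq find_query
  (Seq (Seq (Defs.Sub rstart rnext rone) (Write areach rstart rone))
  (Seq (While rround rn (Seq step (Add rround rround rone)))
       (Read rn areach rstart))))).

(** * Row-major layout of the input tables *)

Lemma nth_flatten_row (T : Type) (x0 : T) (m : nat) (ss : seq (seq T)) i j :
  all (fun s => size s == m) ss -> (j < m)%N ->
  nth x0 (flatten ss) (i * m + j) = nth x0 (nth [::] ss i) j.
Proof.
elim: ss i => [|s ss IH] i /=; first by rewrite !nth_nil.
case/andP => /eqP sm all_m jm; rewrite nth_cat sm.
case: i => [|i] /=; first by rewrite jm.
by rewrite mulSn -addnA ltnNge leq_addr /= addKn IH.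
Qed.

Lemma nth_allpairs_ord (T : Type) (x0 : T) (n m : nat) (f : 'I_n -> 'I_m -> T)
    (i : 'I_n) (j : 'I_m) :
  nth x0 [seq f k l | k <- enum 'I_n, l <- enum 'I_m] (i * m + j) = f i j.
Proof.
rewrite nth_flatten_row //; last first.
  by rewrite all_map; apply/allP => k _ /=; rewrite size_map size_enum_ord.
rewrite (nth_map i) ?size_enum_ord // (nth_map j) ?size_enum_ord //.
by rewrite !nth_ord_enum.
Qed.

Lemma ltr0b (R : numDomainType) (b : bool) : (0 < b%:R :> R) = b.
Proof. by case: b; rewrite ?ltr01 ?ltxx. Qed.

(** * Correctness of the phases of the program *)

Section Instance.
Context {n m : nat} (g : game n m) (q : query g).
Hypothesis cyc : simple_cycle g.
Implicit Types (i : 'I_n) (x : 'I_m) (st : store) (R : {set 'I_m}).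

Definition query_code i : rat :=
  if q i is Some x then (nat_of_ord x).+1%:R else 0.

(** What every round relies on and no round overwrites; the reachable set is kept apart because it
    changes. *)
Record loaded st : Prop := Loaded {
  loaded_n : reg st rn = n%:R;
  loaded_m : reg st rm = m%:R;
  loaded_zero : reg st rzero = 0;
  loaded_one : reg st rone = 1;
  loaded_col : forall i x, arr st acol (i * m + x)%N = (x \in colours g i)%:R;
  loaded_bonus : forall i x, arr st abonus (i * m + x)%N = (bonus g i x)%:~R;
  loaded_query : forall i, arr st aquery i = query_code i;
  loaded_weight : forall i, arr st aweight i = pred_weight g i
}.

Definition preserves_loaded (p : cmd) : bool :=
  all (fun r => r \notin written_regs p) [:: rn; rm; rzero; rone] &&
  all (fun a => a \notin written_arrs p) [:: acol; abonus; aquery; aweight].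

Lemma unchanged_loaded p st st' :
  preserves_loaded p -> unchanged p st st' -> loaded st -> loaded st'.
Proof.
move=> /andP[/and5P[r0 r1 r3 r4 _] /and5P[a3 a4 a5 a6 _]] [ur ua].
by case=> *; split=> *; rewrite ?ur ?ua.
Qed.

(** Reduces a sweep to a loop-free obligation per colour. The invariant must be stable under writes
    to [rx] and [ridx], since the loop itself changes them around the body. *)
Lemma halts_within_sweep body (I : nat -> store -> Prop) i st :
  loaded st -> reg st rbase = (i * m)%:R ->
  preserves_loaded (sweep body) ->
  all (fun r => r \notin written_regs body) [:: rbase; rx; ridx] ->
  (forall k st' v, I k st' ->
     I k (set_reg st' rx v) /\ I k (set_reg st' ridx v)) ->
  I 0%N st ->
  (forall x st', loaded st' -> unchanged (sweep body) st st' ->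
     reg st' rx = (nat_of_ord x)%:R -> reg st' ridx = (i * m + x)%:R ->
     I x st' -> wp body (I x.+1) st') ->
  halts_within (2 + (m * (cost body).+3).+1) (sweep body) st (I m).
Proof.
move=> ld base0 pl; have [r0 r1 r3 r4] : [/\ rn \notin written_regs body,
    rm \notin written_regs body, rzero \notin written_regs body &
    rone \notin written_regs body].
  have sub r : r \notin written_regs (sweep body) -> r \notin written_regs body.
    by apply: contra => h; rewrite /= !inE !mem_cat h !orbT.
  by case/andP: pl => /and5P[? ? ? ? _] _; split; exact: sub.
move=> /and4P[rb rxb ridxb _] stab I0 stepP.
pose J k st' := I k st' /\ reg st' ridx = (i * m + k)%:R.
pose st1 := set_reg (set_reg st rx 0) ridx (i * m)%:R.
apply: (halts_within_seq (Q1 := fun st' => st' = st1)).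
  apply: (@wp_halts (Seq _ _)) => /=.
  by rewrite /upd /= (loaded_zero ld) base0.
move=> _ _ ->.
apply: (@halts_within_le (m * (cost body).+3).+1 _ _ _ (J m)) => //;
  last by move=> st' [].
have -> : ((cost body).+3 = (cost body + 1).+2)%N by rewrite addn1.
have I1 : I 0%N st1 by case: (stab _ _ (i * m)%:R (stab _ _ 0 I0).1).
apply: halts_within_for => //=.
- by rewrite /= !mem_cat !inE !negb_or rxb r1 r4.
- by rewrite /upd /= (loaded_m ld).
- by rewrite /upd /= (loaded_one ld).
- by rewrite /J addn0.
move=> k st' km un kE [Ik idxE].
(* [st1] differs from [st] only in [rx] and [ridx], which the sweep writes anyway. *)
have un' : unchanged (sweep body) st st'.
  split=> z /=; last by move=> zN; rewrite un.2.
  move=> zN; rewrite un.1; last first.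
    by move: zN; rewrite /= !inE !negb_or => /and3P[].
  by move: zN; rewrite /= !inE !negb_or => /and3P[]; rewrite /upd => /negPf -> /negPf ->.
have ld' := unchanged_loaded pl un' ld.
pose x := Ordinal km.
have /wp_halts H := stepP x st' ld' un' kE idxE Ik.
apply: (halts_within_seq H) => st2 un2 I2.
apply: (@wp_halts (Add _ _ _)) => /=; split.
  by case: (stab _ _ k.+1%:R (stab _ _ (reg st2 ridx + reg st2 rone) I2).2).
by rewrite /upd /= !un2.1 // idxE (loaded_one ld') natr1 addnS.
Qed.

Lemma max_bodyP i st :
  loaded st -> reg st rbase = (i * m)%:R -> reg st rfound = 0 ->
  halts_within (2 + (m * (cost max_body).+3).+1) (sweep max_body) st
    (fun st' => max_bonus g i (reg st' rmax)).
Proof.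
move=> ld base f0.
pose I k st' := if reg st' rfound < 1 then
    reg st' rfound = 0 /\ forall z : 'I_m, (z < k)%N -> z \notin colours g i
  else (exists2 z, z \in colours g i & (bonus g i z)%:~R = reg st' rmax) /\
    forall z : 'I_m, (z < k)%N -> z \in colours g i -> (bonus g i z)%:~R <= reg st' rmax.
apply: (@halts_within_le (2 + (m * (cost max_body).+3).+1) _ _ _ (I m)) => //; last first.
  move=> st'; rewrite /I; case: ifP => _ [h1 h2]; last first.
    by split=> // z; exact: h2.
  (* Some colour is available, so the first phase cannot last to the end. *)
  have /set0Pn[z zC] := colours_neq0 g i.
  by have := h2 z (ltn_ord z); rewrite zC.
apply: (halts_within_sweep ld base) => //.
  by rewrite /I f0 ltr01.
move=> x st' ld' un xE idxE Ix.
rewrite /max_body /=.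
exists (i * m + x)%N => //; exists (i * m + x)%N => //=.
rewrite /upd /= (loaded_zero ld') (loaded_one ld') (loaded_col ld') (loaded_bonus ld') ltr0b.
have lt_xS (z : 'I_m) : (z < x.+1)%N -> z = x \/ (z < x)%N.
  by rewrite ltnS leq_eqVlt => /predU1P[/val_inj|]; [left|right].
move: Ix; rewrite /I /=; case: ifP => fd; case: ifP => xC [h1 h2];
  rewrite /upd /= ?ltxx ?fd.
- split=> [|z /lt_xS[->//|/h2/negPf ->//]]; by exists x.
- by split=> // z /lt_xS[->|/h2//]; rewrite xC.
- case: ltP => le; split=> //.
  + by exists x.
  + by move=> z /lt_xS[->//|/h2 h3 /h3 /le_trans]; apply; exact: ltW.
  + by move=> z /lt_xS[->//|/h2].
- by split=> // z /lt_xS[->|/h2//]; rewrite xC.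
Qed.

Lemma switch_bodyP i R M st :
  loaded st -> reg st rbase = (i * m)%:R -> reg st rweight = pred_weight g i ->
  reg st rmax = M -> reg st rswitch = 0 ->
  (forall x, arr st areach x = (x \in R)%:R) ->
  halts_within (2 + (m * (cost switch_body).+3).+1) (sweep switch_body) st
    (fun st' => reg st' rswitch =
       [exists y in R, ~~ ((y \in colours g i) &&
                           (M < (bonus g i y)%:~R + pred_weight g i))]%:R).
Proof.
move=> ld base wE maxE s0 reachE.
pose P y := ~~ ((y \in colours g i) &&
                (M < (bonus g i y)%:~R + pred_weight g i)).
pose I k st' :=
  reg st' rswitch = [exists y in R, (y < k)%N && P y]%:R.
apply: (@halts_within_le (2 + (m * (cost switch_body).+3).+1) _ _ _ (I m))
  => // [|st' ->]; last first.
  by congr (nat_of_bool _)%:R; apply: eq_existsb => y; rewrite ltn_ord.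
apply: (halts_within_sweep ld base) => //.
  by rewrite /I s0; case: existsP => // -[y /and3P[]].
move=> x st' ld' un xE idxE; rewrite /I => Ix.
rewrite /switch_body /=.
exists (i * m + x)%N => //; exists (i * m + x)%N => //=.
exists x => //.
have [wE' maxE'] : reg st' rweight = pred_weight g i /\ reg st' rmax = M.
  by rewrite !un.1.
rewrite /upd /= (loaded_zero ld') (loaded_one ld') (loaded_col ld')
  (loaded_bonus ld') wE' maxE' un.2 // reachE !ltr0b.
have -> : [exists y in R, (y < x.+1)%N && P y] =
    [exists y in R, (y < x)%N && P y] || (x \in R) && P x.
  apply/exists_inP/orP => [[y yR /andP[]]|[/exists_inP[y yR /andP[yx Py]]|/andP[xR Px]]].
  - rewrite ltnS leq_eqVlt => /predU1P[/val_inj <- ->|yx Py].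
      by right; rewrite yR.
    by left; apply/exists_inP; exists y; rewrite ?yx.
  - by exists y; rewrite // Py ltnW.
  - by exists x; rewrite // ltnS leqnn.
rewrite /P; case: ifP => xR; last by rewrite xR orbF.
case: ifP => xC; last by rewrite xR xC orbT.
by case: ifP => lt; rewrite xR xC lt ?orbF ?orbT.
Qed.

(** Overwriting the reachable set in place is sound: the new bit at [x] depends on the old set only
    through its bit at [x] and through [sw], fixed before the sweep. *)
Lemma update_bodyP i R M (sw : bool) st :
  loaded st -> reg st rbase = (i * m)%:R -> reg st rweight = pred_weight g i ->
  reg st rmax = M -> reg st rswitch = sw%:R -> reg st rquery = query_code i ->
  (forall x, arr st areach x = (x \in R)%:R) ->
  halts_within (2 + (m * (cost update_body).+3).+1) (sweep update_body) st
    (fun st' => forall x, arr st' areach x =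
       [&& x \in colours g i, allowed q i x &
         (M <= (bonus g i x)%:~R) && sw
         || (x \in R) && (M <= (bonus g i x)%:~R + pred_weight g i)]%:R).
Proof.
move=> ld base wE maxE swE qE reachE.
pose new x := [&& x \in colours g i, allowed q i x &
  (M <= (bonus g i x)%:~R) && sw
  || (x \in R) && (M <= (bonus g i x)%:~R + pred_weight g i)].
pose I k st' := forall x,
  arr st' areach x = (if (x < k)%N then new x else x \in R)%:R.
apply: (@halts_within_le (2 + (m * (cost update_body).+3).+1) _ _ _ (I m))
  => // [|st' Im x]; last by rewrite Im ltn_ord.
apply: (halts_within_sweep ld base) => //.
move=> x st' ld' un xE idxE Ix.
rewrite /update_body /test_new /=.
exists (i * m + x)%N => //; exists (i * m + x)%N => //=.
exists x => //=.
(* Every branch ends in the same write, so only the value of [rnew] remains to be checked. *)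
have write st1 v : v = (new x)%:R -> arr st1 = arr st' ->
    exists2 k : nat, x%:R = k%:R :> rat & I x.+1 (set_arr st1 areach k v).
  move=> -> arrE; exists (x : nat) => // z.
  rewrite /= arrE /upd /=; case: eqP => [/val_inj ->|zx].
    by rewrite ltnS leqnn.
  by rewrite Ix ltnS [(z <= x)%N]leq_eqVlt (introF eqP zx).
have [wE' maxE' swE' qE'] : [/\ reg st' rweight = pred_weight g i,
    reg st' rmax = M, reg st' rswitch = sw%:R & reg st' rquery = query_code i].
  by rewrite !un.1.
rewrite /upd /= (loaded_zero ld') (loaded_one ld') (loaded_col ld')
  (loaded_bonus ld') wE' maxE' swE' qE' Ix ltnn !ltr0b.
(* Code 0 stands for no query; otherwise two strict comparisons decide equality of the shifted
   colours. *)
have qcE : allowed q i x = ~~ (0 < query_code i) ||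
    ~~ (query_code i < x%:R + 1) && ~~ (x%:R + 1 < query_code i).
  rewrite /allowed /query_code; case: (q i) => [c|]; last by rewrite ltxx.
  by rewrite ltr0Sn natr1 !ltr_nat -!leqNgt !ltnS /= -eqn_leq.
move: write; rewrite /new qcE !leNgt !xE.
case: (x \in colours g i); last by apply.
case: (0 < _); case: (_ < _ + 1); case: (_ + 1 < _); case: (sw);
  case: (_ < M); case: (x \in R); case: (_ < M); by apply.
Qed.

Definition sweep_time (body : cmd) : nat := 2 + (m * (cost body).+3).+1.

Definition step_time : nat :=
  cost advance +
    (sweep_time max_body + (sweep_time switch_body + sweep_time update_body)).

Lemma stepP i R st :
  loaded st -> reg st rnode = (i : nat)%:R -> reg st rbase = (i * m)%:R ->
  (forall x, arr st areach x = (x \in R)%:R) ->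
  halts_within step_time step st (fun st' =>
    [/\ reg st' rnode = (ordS i : nat)%:R, reg st' rbase = (ordS i * m)%:R &
     forall x, arr st' areach x = (x \in next_colours q (ordS i) R)%:R]).
Proof.
move=> ld nodeE baseE reachE; move i'D: (ordS i) => i'.
apply: (halts_within_seq (Q1 := fun st1 =>
  [/\ reg st1 rnode = (i' : nat)%:R, reg st1 rbase = (i' * m)%:R,
      reg st1 rweight = pred_weight g i', reg st1 rquery = query_code i' &
      reg st1 rfound = 0 /\ reg st1 rswitch = 0])).
  apply: (@wp_halts advance); rewrite /= /upd /= nodeE baseE (loaded_n ld)
    (loaded_m ld) (loaded_one ld) -natrD natr1 ltr_nat.
  case: ltnP => lt.
    have i'E : i.+1 = i' by rewrite -i'D /= modn_small.
    rewrite i'E; do 2![exists (i' : nat) => //=].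
    rewrite (loaded_weight ld) (loaded_query ld); split=> //.
    by rewrite -i'E mulSn addnC.
  (* After the last node, both the index and the row offset restart at 0. *)
  have i'E : i' = 0%N :> nat.
    by rewrite -i'D /= (_ : i.+1 = n) ?modnn //; apply/eqP; rewrite eqn_leq lt ltn_ord.
  do 2![exists (i' : nat) => //=; rewrite ?i'E //].
  move: (loaded_weight ld i') (loaded_query ld i'); rewrite i'E => -> ->; split=> //.
move=> st1 un1 [nodeE1 baseE1 wE1 qE1 [fE1 sE1]].
have ld1 : loaded st1 by apply: unchanged_loaded un1 ld.
have reachE1 x : arr st1 areach x = (x \in R)%:R by rewrite un1.2.
apply: (halts_within_seq (max_bodyP ld1 baseE1 fE1)) => st2 un2 maxP.
have ld2 : loaded st2 by apply: unchanged_loaded un2 ld1.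
have [baseE2 wE2 sE2 qE2] : [/\ reg st2 rbase = (i' * m)%:R,
    reg st2 rweight = pred_weight g i', reg st2 rswitch = 0 &
    reg st2 rquery = query_code i'] by rewrite !un2.1.
have reachE2 x : arr st2 areach x = (x \in R)%:R by rewrite un2.2.
have H2 := switch_bodyP ld2 baseE2 wE2 erefl sE2 reachE2.
apply: (halts_within_seq H2) => st3 un3 swE3.
have ld3 : loaded st3 by apply: unchanged_loaded un3 ld2.
have [baseE3 wE3 maxE3 qE3] : [/\ reg st3 rbase = (i' * m)%:R,
    reg st3 rweight = pred_weight g i', reg st3 rmax = reg st2 rmax &
    reg st3 rquery = query_code i'] by rewrite !un3.1.
have reachE3 x : arr st3 areach x = (x \in R)%:R by rewrite un3.2.
have H3 := update_bodyP ld3 baseE3 wE3 maxE3 swE3 qE3 reachE3.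
apply: (halts_within_frame H3) => st4 un4 newP; split.
- by rewrite un4.1 // un3.1 // un2.1.
- by rewrite un4.1.
- by move=> x; rewrite newP (mem_next_colours q cyc _ _ maxP).
Qed.

Lemma load_weightsP es st i0 :
  edge_list g es -> reg st re = (size es)%:R -> reg st rk = 0 ->
  reg st rone = 1 ->
  (forall k, arr st atgt k =
     nth 0 [seq (nat_of_ord a.2)%:R | a <- es : seq ('I_n * 'I_n)] k) ->
  (forall k, arr st aedge k = nth 0 [seq weight g a.1 a.2 | a <- es] k) ->
  halts_within (size es * 5).+1 load_weights st
    (fun st' => forall i, arr st' aweight i = pred_weight g i).
Proof.
move=> [_ esE] eE kE oneE tgtE wE.
pose I k st' := forall a, a \in take k es ->
  arr st' aweight a.2 = weight g a.1 a.2.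
apply: (@halts_within_le (size es * 5).+1 _ _ _ (I (size es))) => // [|st']; last first.
  rewrite /I take_size => Ies i; apply: (Ies (ord_pred i, i)).
  by rewrite esE inE edge_pred.
apply: halts_within_for => // [a|k st' kes un kE' Ik]; first by rewrite take0.
apply: (@wp_halts (Seq _ _)) => /=.
pose a0 := nth (i0, i0) es k.
exists k => //; exists k => //; exists (a0.2 : nat) => //=.
  by rewrite /upd /= un.2 // tgtE (nth_map (i0, i0)).
move=> a; rewrite (take_nth (i0, i0)) // mem_rcons inE -/a0 => mem_a.
(* On a cycle, listed edges with the same target have the same source, so an overwrite stores the
   same weight. *)
rewrite /= /upd /=; case: eqP => [/val_inj e|ne]; last first.
  by case/predU1P: mem_a => [aE|/Ik//]; rewrite aE in ne.
have edges_es b : b \in es -> b.1 = ord_pred b.2.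
  by rewrite esE inE (edge_cycleE cyc) => /eqP.
have aes : a \in es by case/predU1P: mem_a => [->|/mem_take//]; exact: mem_nth.
rewrite un.2 // wE (nth_map (i0, i0)) // -/a0 (edges_es a) // e.
by rewrite (edges_es a0) // mem_nth.
Qed.

Lemma find_queryP st :
  loaded st -> reg st rx = 0 -> reg st ridx = 0 ->
  halts_within (n * (cost find_query_body).+2).+1 find_query st
    (fun st' => exists i x, [/\ q i = Some x, reg st' rnode = (i : nat)%:R,
       reg st' rbase = (i * m)%:R & reg st' rnext = (x : nat).+1%:R]).
Proof.
move=> ld xE idxE.
pose found st' := exists i x, [/\ q i = Some x, reg st' rnode = (i : nat)%:R,
       reg st' rbase = (i * m)%:R & reg st' rnext = (x : nat).+1%:R].
(* Either no query has been met among the first [k] nodes, or the registers describe a queried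
   node. *)
pose I k st' := reg st' ridx = (k * m)%:R /\
  ((forall i, (i < k)%N -> q i = None) \/ found st').
apply: (@halts_within_le (n * (cost find_query_body).+2).+1 _ _ _ (I n)) => //;
  last first.
  move=> st' [_ [none|//]]; have [i] := query_neq0 q.
  by rewrite none.
apply: halts_within_for => //=.
- exact: loaded_n.
- exact: loaded_one.
- by split=> //; left.
move=> k st' kn un kE [idxE' IH].
have ld' : loaded st' by apply: unchanged_loaded un ld.
apply: (@wp_halts (Seq _ _)) => /=.
pose i : 'I_n := Ordinal kn.
exists k => //; rewrite /upd /= (loaded_zero ld') (loaded_query ld' i) /query_code.
case qi: (q i) => [c|]; rewrite ?ltr0Sn ?ltxx /= /I /= /upd /=
  idxE' (loaded_m ld') -natrD -mulSnr; split=> //.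
  by right; exists i, c; split.
case: IH => [none|]; last by right.
left=> j; rewrite ltnS leq_eqVlt => /predU1P[jk|/none//].
by rewrite (_ : j = i) //; exact: val_inj.
Qed.

End Instance.

(** * Assembly of the phases and the linear time bound *)

Lemma solveP n m (g : game n m) (q : query g) es :
  (0 < n)%N -> simple_cycle g -> edge_list g es ->
  halts_within (1000 * game_size g) solve (input q es)
    (fun st => answers st (exists_NE q)).
Proof.
move=> n_gt0 cyc esP; set st0 := input q es.
have [i0 qi0] := query_neq0 q.
(* The queried node has a colour, so [m] is positive; this lets [n * m] absorb the constant overhead
   per node. *)
have m_gt0 : (0 < m)%N.
  by case: (q i0) qi0 => // c _; exact: leq_ltn_trans (ltn_ord c).
have size_es : size es = #|edges g|.
  by case: esP => /card_uniqP <- /eq_card.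
(* The summands are the time bounds of the phases of [solve], in order; 1000 is a generous bound on
   their constants. *)
set T := (1 + ((size es * 5).+1 + ((n * (cost find_query_body).+2).+1 +
   (2 + ((n * (step_time (m := m)).+2).+1 + 1)))))%N.
apply: (@halts_within_le T _ _ _ (fun st => answers st (exists_NE q))) => //; last first.
  rewrite /T /game_size size_es /step_time /sweep_time /=.
  nia.
apply: (halts_within_seq (Q1 := fun st => st = set_reg st0 rone 1%:~R)).
  exact: (@wp_halts (Const _ _)).
move=> _ _ ->; set st1 := set_reg st0 rone 1%:~R.
have H1 := @load_weightsP n m g cyc es st1 i0 esP.
apply: (halts_within_seq (H1 _ _ _ _ _)) => //.
move=> st2 un2 weightE.
have ld2 : loaded q st2.
  split=> [||||j x|j x|j|//]; rewrite ?un2.1 ?un2.2 //.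
  - exact: nth_allpairs_ord.
  - exact: nth_allpairs_ord.
  - by rewrite /= (nth_map j) ?size_enum_ord // nth_ord_enum.
have H2 := @find_queryP n m g q st2 ld2.
apply: (halts_within_seq (H2 _ _)); rewrite ?un2.1 //.
move=> st3 un3 [i [c [qi nodeE baseE nextE]]].
have ld3 : loaded q st3 by apply: unchanged_loaded un3 ld2.
apply: (halts_within_seq (Q1 := fun st =>
  reg st rstart = (c : nat)%:R /\
  forall x : 'I_m, arr st areach x = (x \in [set c])%:R)).
  apply: (@wp_halts (Seq _ _)) => /=; exists (c : nat).
    (* [rnext] holds the queried colour in shifted form [c + 1], so the subtraction recovers [c]. *)
    by rewrite /upd /= nextE (loaded_one ld3) -natr1 addrK.
  rewrite /upd /= nextE (loaded_one ld3) -natr1 addrK; split=> // x.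
  rewrite inE (inj_eq val_inj); case: ifP => // _.
  (* Array [areach] is absent from the input and still 0 everywhere, so the single write encodes the
     set of [c] alone. *)
  by rewrite un3.2 // un2.2 //= nth_nil.
move=> st4 un4 [startE reachE4].
have ld4 : loaded q st4 by apply: unchanged_loaded un4 ld3.
pose I k st := [/\ reg st rnode = (node_after n_gt0 i k : nat)%:R,
  reg st rbase = (node_after n_gt0 i k * m)%:R &
  forall x : 'I_m, arr st areach x = (x \in reachable q n_gt0 i c k)%:R].
apply: (halts_within_seq (Q1 := I n)).
  apply: halts_within_for => //.
  - by rewrite un4.1 // un3.1 // un2.1.
  - exact: loaded_n ld4.
  - exact: loaded_one ld4.
  - by split; rewrite ?node_after0 ?un4.1.
  move=> k st kn un kE [nodeEk baseEk reachEk].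
  have ld : loaded q st by apply: unchanged_loaded un ld4.
  apply: (halts_within_le (stepP cyc ld nodeEk baseEk reachEk)) => //.
  by move=> st'; rewrite -(ord_pred_node_after n_gt0 i k) ord_predK.
move=> st5 un5 [_ _ reachE5].
apply: (@wp_halts (Read _ _ _)) => /=; exists (c : nat); first by rewrite un5.1.
rewrite /answers /= /upd /= reachE5.
have NE := exists_NE_reachable cyc n_gt0 qi.
case cR: (c \in _); [left|right]; split=> //; first exact/NE.
by move/NE; rewrite cR.
Qed.

Local Close Scope ring_scope.

Theorem theorem5 :
  exists (p : cmd) (K : nat),
    forall (n m : nat) (g : game n m) (q : query g) (es : seq ('I_n * 'I_n)),
      1 < n -> simple_cycle g -> edge_list g es ->
      exists (t : nat) (st : store),
        [/\ exec p (input q es) t st,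
            t <= K * game_size g
          & answers st (exists_NE q)].
Proof.
exists solve, 1000 => n m g q es n1 cyc esP.
have [t [st [e le A]]] := solveP q (ltnW n1) cyc esP.
by exists t, st; split.
Qed.
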